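(* Let $X\in\mathbb{R}^d$ be a centered random vector with covariance matrix $\Sigma$, and let $h:[1,\infty)\to[0,\infty]$ be a non-decreasing function such that for every $u\in\mathbb{R}^d$ and every $p\ge 2$, $$\left(\mathbb{E}\left(|\langle u,X\rangle|^p\right)\right)^{1/p}\le h(p)\,\|u\|_\Sigma .$$ Then for any $t>0$, with probability at least $1-e^{-t}$, $$\|X\|_2\le \inf_{p\ge 2}\ 2p^{-1/2}h(p)\left(\operatorname{tr}(\Sigma)+\frac{p}{2}\|\Sigma\|_{\mathrm{op}}\right)^{1/2}e^{(t+\log 2)/p}.$$
   Context: For a positive semidefinite matrix $M$, $\|u\|_M=\sqrt{u^\top M u}$. $\|\cdot\|_2$ is the Euclidean norm and $\|\cdot\|_{\mathrm{op}}$ the operator (spectral) norm. *)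

(* Defs.v *)
From mathcomp Require Import all_boot all_order all_algebra.
From mathcomp Require Import all_classical all_reals all_analysis.

Set Implicit Arguments.
Unset Strict Implicit.
Unset Printing Implicit Defensive.

Import Order.TTheory GRing.Theory Num.Theory.
Import numFieldNormedType.Exports.

Local Open Scope classical_set_scope.
Local Open Scope ring_scope.

Definition dotv {R : realType} {d : nat} (u v : 'cV[R]_d) : R :=
  \sum_(i < d) u i 0 * v i 0.

(* The norm `|v| that the library puts on matrices is the max norm, hence this
   separate definition. *)
Definition norm2 {R : realType} {d : nat} (v : 'cV[R]_d) : R :=
  Num.sqrt (\sum_(i < d) v i 0 ^+ 2).

Definition norm_mx {R : realType} {d : nat} (M : 'M[R]_d) (u : 'cV[R]_d) : R :=
  Num.sqrt ((u^T *m M *m u) 0 0).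

(* The unit ball, unlike the unit sphere, is nonempty also for d = 0; the
   supremum is over a nonempty bounded set in every dimension. *)
Definition opnorm {R : realType} {d : nat} (M : 'M[R]_d) : R :=
  sup [set norm2 (M *m u) | u in [set u : 'cV[R]_d | norm2 u <= 1]].

Definition rvec {d0 : measure_display} {T : measurableType d0} {R : realType}
    {P : probability T R} {d : nat} (X : 'I_d -> {RV P >-> R}) (w : T) :
    'cV[R]_d :=
  \col_(i < d) X i w.

(* Main.v *)
Require Import Defs.
From mathcomp Require Import all_boot all_order all_algebra.
From mathcomp Require Import all_classical all_reals all_analysis.
From mathcomp Require Import measurable_realfun complex ring lra.

(* Average the moment hypothesis over a standard Gaussian direction [g]: since
   [E_g |<g, x>|^p = E|g_1|^p |x|^p], Fubini gives
   [E|g_1|^p E|X|^p <= h(p)^p E_g (g^T Sigma g)^(p/2)], and Markov's inequality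
   concludes once [E|g_1|^p >= (p/4)^(p/2) / 2] and
   [E_g (g^T Sigma g)^(p/2) <= (tr Sigma + p/2 |Sigma|_op)^(p/2)].
   Both moment bounds follow from the even integer moments by tangent-line
   inequalities, and those moments only use Stein's identity
   [E[g_i f(g)] = E[d_i f(g)]] for polynomials [f] of bounded degree. Hence [g]
   may be replaced by a finitely supported vector with independent coordinates
   distributed as a Gauss-Hermite quadrature rule, which turns all the averages
   over [g] into finite sums. *)

Set Implicit Arguments.
Unset Strict Implicit.
Unset Printing Implicit Defensive.

Import Order.TTheory GRing.Theory Num.Theory.
Import numFieldNormedType.Exports.

Local Open Scope classical_set_scope.
Local Open Scope ring_scope.

(** * Gaussian quadrature from a truncated harmonic oscillator *)

(** By the spectral theorem over [R[i]], the nodes are the eigenvalues of [J], which are real, and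
    the weights are the squared moduli of the first column of the diagonalizing unitary matrix. *)
Lemma symmetric_moment_quadrature (R : rcfType) (n : nat) (J : 'M[R]_n.+1) :
  J^T = J ->
  exists x w : 'I_n.+1 -> R, [/\ forall j, 0 <= w j &
    forall q : {poly R}, \sum_j w j * q.[x j] = (horner_mx J q) 0 0].
Proof.
move=> symJ; pose toC : {rmorphism R -> R[i]} := real_complex R.
pose A : 'M[R[i]]_n.+1 := map_mx toC J.
have reA : A \is a mxOver Num.real.
  by apply/mxOverP => i j; rewrite mxE complex_real.
have hA : A \is hermsymmx.
  apply: realsym_hermsym => //.
  apply/is_hermitianmxP; rewrite expr0 scale1r map_mx_id//.
  by rewrite /A -[in LHS]symJ; apply/matrixP => i j; rewrite !mxE.
have Anorm := hermitian_normalmx hA.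
have /orthomx_spectralP := Anorm.
set U := spectralmx A; set D := spectral_diag A => AE.
have Uu : U \is unitarymx by exact: spectral_unitarymx.
have Dreal : D \is a mxOver Num.real by exact: hermitian_spectral_diag_real.
exists (fun j => complex.Re (D 0 j)), (fun j => complex.Re (`|U j 0| ^+ 2)).
split=> [j|q].
  by rewrite -lecR RRe_real ?rpredX ?normr_real// exprn_ge0.
apply: (@complexI R); rewrite -[LHS]/(toC _) -[RHS]/(toC _).
have -> : toC (horner_mx J q 0 0) = horner_mx A (map_poly toC q) 0 0.
  by rewrite /A -map_horner_mx mxE.
rewrite AE horner_mx_uconjC; last exact: unitarymx_unit.
rewrite horner_mx_diag mul_mx_diag invmx_unitary//.  rewrite mxE rmorph_sum.
apply: eq_bigr => j _.
have reC (z : R[i]) : z \is Num.real -> toC (complex.Re z) = z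
  by exact: RRe_real.
rewrite !mxE rmorphM -horner_map !reC ?rpredX ?normr_real//; last exact/mxOverP.
by rewrite normCK [RHS]mulrC mulrA.
Qed.

(* The real functions on [nat] carry the creation and annihilation operators
   [(A f) i = sqrt (i + 1) * f (i + 1)] and [(B f) i = sqrt i * f (i - 1)], which
   satisfy [A B - B A = 1]; the sequence below is [(A + B) ^ m] applied to the
   indicator of [0]. *)
Fixpoint oscillator (R : rcfType) (m i : nat) : R :=
  if m is m'.+1 then
    Num.sqrt i.+1%:R * oscillator R m' i.+1 + Num.sqrt i%:R * oscillator R m' i.-1
  else (i == 0)%:R.

(** In operator terms, [A (A + B)^m e_0 = m (A + B)^(m-1) e_0], from [[A, A + B] = 1] and
    [A e_0 = 0]. At [i = 0] this is Stein's identity for monomials. *)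
Lemma oscillator_lower (R : rcfType) (m i : nat) :
  Num.sqrt i.+1%:R * oscillator R m i.+1 = m%:R * oscillator R m.-1 i.
Proof.
have sqrtM k : Num.sqrt k%:R * Num.sqrt k%:R = k%:R :> R.
  by rewrite -expr2 sqr_sqrtr ?ler0n.
elim: m i => [|[|m] IH] i; first by rewrite /= mulr0 mul0r.
  by case: i => [|i]; rewrite /= ?sqrtr0 ?sqrtr1 !(mulr0, add0r, mul0r, mulr1).
have osc2 : oscillator R m.+2 i.+1 = Num.sqrt i.+2%:R * oscillator R m.+1 i.+2 +
  Num.sqrt i.+1%:R * oscillator R m.+1 i by [].
have osc1 : Num.sqrt i.+1%:R * oscillator R m i.+1 =
    oscillator R m.+1 i - Num.sqrt i%:R * oscillator R m i.-1.
  by rewrite [oscillator R m.+1 i]/= addrK.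
have osci : i%:R * oscillator R m.+1 i =
    m.+1%:R * (Num.sqrt i%:R * oscillator R m i.-1).
  case: i {osc1 osc2} => [|i]; first by rewrite sqrtr0 !mul0r mulr0.
  by rewrite -{1}sqrtM -mulrA IH mulrCA.
rewrite osc2 IH !succnK mulrDr mulrA sqrtM mulrCA osc1 mulrBr -osci.
rewrite -[m.+2]addn1 -[i.+1]addn1 !natrD. ring.
Qed.

Lemma oscillator_support (R : rcfType) (m i : nat) :
  (m < i)%N -> oscillator R m i = 0.
Proof.
elim: m i => [|m IH] [|i]//= lt_mi.
by rewrite !IH ?mulr0 ?addr0// ltnW// ltnW.
Qed.

(** Equivalently, a probability law on the nodes whose moments up to order [D] are the standard
    Gaussian ones: [q] has degree below [D], and the factor [x j] raises the order by one. *)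
Definition stein_upto {R : realFieldType} {N : nat} (x w : 'I_N -> R) (D : nat) :=
  [/\ forall j, 0 <= w j, \sum_j w j = 1 &
    forall q : {poly R}, (size q <= D)%N ->
      \sum_j w j * (x j * q.[x j]) = \sum_j w j * (q^`()).[x j]].

(* The compression of [A + B] to the indices [0 .. D] is a finite Jacobi matrix,
   whose [(0, 0)] moments of order at most [D] are those of [A + B]. *)
Lemma gauss_quadrature (R : rcfType) (D : nat) :
  exists x w : 'I_D.+1 -> R, stein_upto x w D.
Proof.
pose J : 'M[R]_D.+1 := \matrix_(i, j)
  (Num.sqrt j%:R * (i.+1 == j)%:R + Num.sqrt i%:R * (j.+1 == i)%:R).
have [x [w [w_ge0 xwE]]] : exists x w : 'I_D.+1 -> R, [/\ forall j, 0 <= w j &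
    forall q : {poly R}, \sum_j w j * q.[x j] = (horner_mx J q) 0 0].
  by apply: symmetric_moment_quadrature; apply/matrixP => i j; rewrite !mxE addrC.
(* Truncation to the indices [0 .. D] is harmless for [m <= D], since the [m]-th iterate is
   supported on [0 .. m]. *)
have JXE m (i : 'I_D.+1) : (m <= D)%N -> (J ^+ m) i 0 = oscillator R m i.
  elim: m i => [|m IH] i m_le; first by rewrite expr0 mxE.
  rewrite exprS mxE.
  under eq_bigr => j _ do rewrite IH ?(ltnW m_le)// mxE mulrDl.
  rewrite big_split /=; congr (_ + _).
    have [iD|iD] := ltnP i.+1 D.+1.
      rewrite (bigD1 (Ordinal iD))//= eqxx mulr1 big1 ?addr0// => j ji.
      by rewrite -[_ == j :> nat]/(Ordinal iD == j :> 'I__) eq_sym (negPf ji)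
        mulr0 mul0r.
    have -> : oscillator R m i.+1 = 0.
      by rewrite oscillator_support// (leq_trans _ iD)// ltnS ltnW.
    rewrite mulr0 big1// => j _.
    by rewrite (gtn_eqF (leq_trans (ltn_ord j) iD)) mulr0 mul0r.
  case: i => -[|i] /= iD.
    by rewrite sqrtr0 [RHS]mul0r big1// => j _; rewrite mul0r ?mulr0 ?mul0r.
  rewrite (bigD1 (Ordinal (ltnW iD)))//= eqxx mulr1 big1 ?addr0// => j ji.
  rewrite eqSS -[_ == i :> nat]/(j == Ordinal (ltnW iD) :> 'I__) (negPf ji).
  by rewrite mulr0 mul0r.
have momE m : (m <= D)%N -> \sum_j w j * x j ^+ m = oscillator R m 0.
  move=> mD; rewrite -(JXE _ ord0)//.
  under eq_bigr => j _ do rewrite -hornerXn.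
  by rewrite xwE rmorphXn /= horner_mx_X.
exists x, w; split=> // [|q q_size].
  by have := momE 0 isT; under eq_bigr => j _ do rewrite expr0 mulr1.
rewrite -[q]coefK poly_def.
rewrite [in RHS]linear_sum.
under [RHS]eq_bigr => j _ do rewrite horner_sum mulr_sumr.
under [LHS]eq_bigr => j _ do rewrite horner_sum 2!mulr_sumr.
rewrite exchange_big [RHS]exchange_big; apply: eq_bigr => i _ /=.
have iD : (i < D)%N by rewrite (leq_trans (ltn_ord i)).
(* Linearity has reduced the claim to monomials; both sides are now moments, related by the lowering
   identity at index [0]. *)
transitivity (q`_i * oscillator R i.+1 0).
  rewrite -momE// mulr_sumr; apply: eq_bigr => j _.
  by rewrite hornerZ hornerXn exprS; ring.
transitivity (q`_i * (i%:R * oscillator R i.-1 0)); last first.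
  rewrite -momE ?(leq_trans (leq_pred _)) ?(ltnW iD)// !mulr_sumr.
  apply: eq_bigr => j _.
  by rewrite derivZ derivXn hornerZ hornerMn hornerXn -mulr_natl; ring.
by rewrite -oscillator_lower /= sqrtr0 mul0r addr0.
Qed.

(** * Averages over product grids and integration by parts *)

Definition grid {R : realFieldType} {N d : nat} (x : 'I_N -> R)
    (s : {ffun 'I_d -> 'I_N}) : 'cV[R]_d :=
  \col_i x (s i).

(** The expectation of [F] at a vector with independent coordinates that all follow the quadrature
    rule. *)
Definition grid_mean {R : realFieldType} {N d : nat} (x w : 'I_N -> R)
    (F : 'cV[R]_d -> R) : R :=
  \sum_(s : {ffun 'I_d -> 'I_N}) (\prod_i w (s i)) * F (grid x s).

Definition qform {R : realFieldType} {d : nat} (S : 'M[R]_d) (v : 'cV[R]_d) : R :=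
  (v^T *m S *m v) 0 0.

Definition zero_coord {R : realFieldType} {d : nat} (i : 'I_d) (v : 'cV[R]_d) :
    'cV[R]_d :=
  \col_k (if k == i then 0 else v k 0).

(** Redrawing coordinate [i] independently does not change the law: exchanging the old value with
    the new one is an involution that preserves the product weight, and the extra weight sums to
    [1]. *)
Lemma grid_mean_resample (R : realFieldType) (N d : nat) (w : 'I_N -> R)
    (F : {ffun 'I_d -> 'I_N} -> R) (i : 'I_d) : \sum_j w j = 1 ->
  \sum_(s : {ffun 'I_d -> 'I_N}) (\prod_k w (s k)) * F s =
  \sum_(s : {ffun 'I_d -> 'I_N}) (\prod_k w (s k)) *
    (\sum_j w j * F [ffun k => if k == i then j else s k]).
Proof.
move=> w1; pose upd (s : {ffun 'I_d -> 'I_N}) j : {ffun 'I_d -> 'I_N} :=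
  [ffun k => if k == i then j else s k].
pose swap (a : {ffun 'I_d -> 'I_N} * 'I_N) := (upd a.1 a.2, a.1 i).
have swapK : involutive swap.
  move=> [s j]; rewrite /swap /= ffunE eqxx; congr pair.
  by apply/ffunP => k; rewrite !ffunE; case: eqP => // ->.
under [RHS]eq_bigr => s _ do rewrite mulr_sumr.
rewrite pair_big /= (reindex swap) /=; last exact/onW_bij/inv_bij.
under [RHS]eq_bigr => a _.
  have -> : \prod_k w (upd a.1 a.2 k) * (w (a.1 i) *
      F [ffun k => if k == i then a.1 i else upd a.1 a.2 k]) =
      \prod_k w (a.1 k) * F a.1 * w a.2.
    have -> : [ffun k => if k == i then a.1 i else upd a.1 a.2 k] = a.1.
      by apply/ffunP => k; rewrite !ffunE; case: eqP => // ->.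
    rewrite (bigD1 i)//= [in RHS](bigD1 i)//= ffunE eqxx.
    rewrite (eq_bigr (fun k => w (a.1 k))); first by ring.
    by move=> k /negPf ki; rewrite ffunE ki.
  over.
rewrite -(pair_big xpredT xpredT
  (fun (s : {ffun 'I_d -> 'I_N}) j => \prod_k w (s k) * F s * w j)) /=.
by apply: eq_bigr => s _; rewrite -mulr_sumr w1 mulr1.
Qed.

(** Once coordinate [i] is redrawn, the inner sum runs over that coordinate alone. The polynomial
    sees [v] only through [zero_coord i v], so it stays fixed there and the one-dimensional Stein
    identity applies. *)
Lemma grid_mean_by_parts (R : realFieldType) (N d D : nat) (x w : 'I_N -> R)
    (q : 'cV[R]_d -> {poly R}) (i : 'I_d) : stein_upto x w D ->
  (forall v, (size (q v) <= D)%N) ->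
  grid_mean x w (fun v => v i 0 * (q (zero_coord i v)).[v i 0]) =
  grid_mean x w (fun v => ((q (zero_coord i v))^`()).[v i 0]).
Proof.
move=> [_ w1 xwP] qD; rewrite /grid_mean.
rewrite [LHS](grid_mean_resample _ i w1) [RHS](grid_mean_resample _ i w1).
apply: eq_bigr => s _; congr (_ * _).
have zE j : zero_coord i (grid x [ffun k => if k == i then j else s k]) =
    zero_coord i (grid x s).
  by apply/colP => k; rewrite !mxE ffunE; case: eqP.
have gE j : grid x [ffun k => if k == i then j else s k] i 0 = x j.
  by rewrite mxE ffunE eqxx.
under eq_bigr => j _ do rewrite zE gE.
by under [RHS]eq_bigr => j _ do rewrite zE gE; exact: xwP.
Qed.

Lemma grid_meanD (R : realFieldType) (N d : nat) (x w : 'I_N -> R)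
    (F G : 'cV[R]_d -> R) :
  grid_mean x w (fun v => F v + G v) = grid_mean x w F + grid_mean x w G.
Proof. by rewrite -big_split; apply: eq_bigr => s _; rewrite mulrDr. Qed.

Lemma grid_meanZ (R : realFieldType) (N d : nat) (x w : 'I_N -> R) (a : R)
    (F : 'cV[R]_d -> R) :
  grid_mean x w (fun v => a * F v) = a * grid_mean x w F.
Proof. by rewrite mulr_sumr; apply: eq_bigr => s _; rewrite mulrCA. Qed.

Lemma grid_mean_sum (R : realFieldType) (N d : nat) (x w : 'I_N -> R) (n : nat)
    (F : 'I_n -> 'cV[R]_d -> R) :
  grid_mean x w (fun v => \sum_i F i v) = \sum_i grid_mean x w (F i).
Proof. by rewrite exchange_big; apply: eq_bigr => s _; rewrite mulr_sumr. Qed.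

Lemma grid_mean_le (R : realFieldType) (N d : nat) (x w : 'I_N -> R)
    (F G : 'cV[R]_d -> R) : (forall j, 0 <= w j) -> (forall v, F v <= G v) ->
  grid_mean x w F <= grid_mean x w G.
Proof.
by move=> w0 FG; apply: ler_sum => s _; rewrite ler_wpM2l ?FG// prodr_ge0.
Qed.

Lemma grid_mean1 (R : realFieldType) (N d : nat) (x w : 'I_N -> R) :
  \sum_j w j = 1 -> grid_mean x w (fun _ : 'cV[R]_d => 1) = 1.
Proof.
move=> w1; rewrite /grid_mean; under eq_bigr => s _ do rewrite mulr1.
by rewrite -(bigA_distr_bigA (fun _ : 'I_d => w)) /= big1.
Qed.

(** * Quadratic forms and their moment recursion *)

Lemma qformE (R : realFieldType) (d : nat) (S : 'M[R]_d) (v : 'cV[R]_d) :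
  qform S v = \sum_i v i 0 * (S *m v) i 0.
Proof. by rewrite /qform -mulmxA mxE; apply: eq_bigr => i _; rewrite mxE. Qed.

Lemma qform_eq0 (R : realFieldType) (d : nat) (S : 'M[R]_d) (v : 'cV[R]_d) :
  \sum_i (S *m v) i 0 ^+ 2 <= 0 -> qform S v = 0.
Proof.
move=> Sv_le0; rewrite qformE big1// => i _.
suff -> : (S *m v) i 0 = 0 by rewrite mulr0.
apply/eqP; rewrite -sqrf_eq0 eq_le sqr_ge0 andbT; apply: le_trans Sv_le0.
by rewrite (bigD1 i)//= lerDl sumr_ge0// => j _; rewrite sqr_ge0.
Qed.

Lemma psd_trace_ge0 (R : realFieldType) (d : nat) (S : 'M[R]_d) :
  (forall u, 0 <= qform S u) -> 0 <= \tr S.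
Proof.
move=> psd; apply: sumr_ge0 => i _; have := psd (delta_mx i 0).
by rewrite /qform trmx_delta -rowE -colE !mxE.
Qed.

Lemma zero_coord_decomp (R : realFieldType) (d : nat) (i : 'I_d) (v : 'cV[R]_d) :
  v = zero_coord i v + v i 0 *: delta_mx i 0.
Proof.
apply/colP => k; rewrite !mxE eqxx andbT.
by have [->|] := eqVneq k i; rewrite ?mulr1 ?add0r ?mulr0 ?addr0.
Qed.

Lemma mulmx_zero_coord (R : realFieldType) (d : nat) (S : 'M[R]_d) (i : 'I_d)
    (v : 'cV[R]_d) :
  (S *m v) i 0 = (S *m zero_coord i v) i 0 + S i i * v i 0.
Proof.
rewrite [in LHS](zero_coord_decomp i v) mulmxDr -scalemxAr mxE; congr (_ + _).
by rewrite mxE -colE mxE mulrC.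
Qed.

Lemma qform_zero_coord (R : realFieldType) (d : nat) (S : 'M[R]_d) (i : 'I_d)
    (v : 'cV[R]_d) : S^T = S ->
  qform S v = qform S (zero_coord i v) +
    (S *m zero_coord i v) i 0 * v i 0 *+ 2 + S i i * v i 0 ^+ 2.
Proof.
move=> symS; set u := zero_coord i v; set z := v i 0.
have Svi (y : 'cV[R]_d) : \sum_k y k 0 * S k i = (S *m y) i 0.
  by rewrite mxE; apply: eq_bigr => k _; rewrite -{1}symS mxE mulrC.
have vE k : v k 0 = u k 0 + z * (k == i)%:R.
  by rewrite {1}(zero_coord_decomp i v) !mxE eqxx andbT.
have SvE k : (S *m v) k 0 = (S *m u) k 0 + z * S k i.
  rewrite {1}(zero_coord_decomp i v) mulmxDr -scalemxAr mxE; congr (_ + _).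
  by rewrite mxE -colE mxE.
rewrite !qformE.
under eq_bigr => k _ do rewrite vE SvE mulrDl.
rewrite big_split /= [X in _ + X](bigD1 i)//= eqxx [X in _ + (_ + X)]big1; last first.
  by move=> k /negPf ki; rewrite ki !(mulr0, mul0r).
under eq_bigr => k _ do rewrite mulrDr.
rewrite big_split /=.
have -> : \sum_k u k 0 * (z * S k i) = z * (S *m u) i 0.
  by rewrite -Svi mulr_sumr; apply: eq_bigr => k _; rewrite mulrCA.
by rewrite mulr1; ring.
Qed.

(* Along the [i]-th axis both [qform S] and [(S *m v) i 0] are polynomials, with
   coefficients depending only on [zero_coord i v]. *)
Lemma grid_mean_qformS (R : realFieldType) (N d D k : nat) (x w : 'I_N -> R)
    (S : 'M[R]_d) : S^T = S -> stein_upto x w D ->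
  (k.*2.+2 <= D)%N ->
  grid_mean x w (fun v => qform S v ^+ k.+1) =
  \tr S * grid_mean x w (fun v => qform S v ^+ k) +
  k.*2%:R * grid_mean x w (fun v => (\sum_i (S *m v) i 0 ^+ 2) * qform S v ^+ k.-1).
Proof.
move=> symS xwP kD.
have hornerS := (hornerD, hornerZ, hornerC, hornerX, hornerXn).
pose a i (v : 'cV[R]_d) : R := (S *m v) i 0.
pose l i v : {poly R} := (a i v)%:P + S i i *: 'X.
pose p i v : {poly R} := (qform S v)%:P + (a i v *+ 2) *: 'X + S i i *: 'X^2.
have lE i v : (l i (zero_coord i v)).[v i 0] = a i v.
  by rewrite /l !hornerE /a [RHS](mulmx_zero_coord _ i).
have pE i v : (p i (zero_coord i v)).[v i 0] = qform S v.
  by rewrite /p !hornerS /a [RHS](qform_zero_coord i)// mulrnAl.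
(* The derivative of [p] is twice [l], whence the factor [2k]; summing over [i] produces the trace
   and [|S v|^2]. *)
have dE i v : ((l i (zero_coord i v) * p i (zero_coord i v) ^+ k)^`()).[v i 0] =
    S i i * qform S v ^+ k + k.*2%:R * (a i v ^+ 2 * qform S v ^+ k.-1).
  have l'E : (l i (zero_coord i v))^`() = (S i i)%:P.
    by rewrite /l derivD derivC add0r derivZ derivX alg_polyC.
  have p'E : ((p i (zero_coord i v))^`()).[v i 0] = a i v *+ 2.
    rewrite /p !derivD derivC add0r !derivZ derivX derivXn /= expr1.
    rewrite -(lE i v) /l !hornerS; ring.
  rewrite derivM l'E deriv_exp hornerD !hornerM hornerMn hornerM !horner_exp.
  rewrite lE pE p'E hornerC -muln2 natrM -[_ *+ k]mulr_natl; ring.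
(* The degrees of [l] and [p] are at most [1] and [2], so [l * p ^ k] has size at most [2k + 2],
   which explains the bound on [D]. *)
have sz i v : (size (l i v * p i v ^+ k)%R <= D)%N.
  have lpS (f : {poly R}) n c : (size f <= n)%N -> (size (c *: f)%R <= n)%N.
    by move=> fn; rewrite (leq_trans (size_scale_leq _ _)).
  have szl : (size (l i v) <= 2)%N.
    rewrite (leq_trans (size_polyD _ _))// geq_max lpS ?size_polyX// andbT.
    by rewrite (leq_trans (size_polyC_leq1 _)).
  have szp : (size (p i v) <= 3)%N.
    rewrite (leq_trans (size_polyD _ _))// geq_max lpS ?size_polyXn// andbT.
    rewrite (leq_trans (size_polyD _ _))// geq_max lpS ?size_polyX// andbT.
    by rewrite (leq_trans (size_polyC_leq1 _)).
  have szpk : (size (p i v ^+ k)%R <= k.*2.+1)%N.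
    rewrite (leq_trans (size_poly_exp_leq _ _))// ltnS -mul2n leq_mul2r.
    by rewrite -subn1 leq_subLR szp orbT.
  rewrite (leq_trans _ kD)// (leq_trans (size_polyMleq _ _))//.
  by rewrite -subn1 leq_subLR; apply: leq_trans (leq_add szl szpk) _.
transitivity (grid_mean x w (fun v => \sum_i v i 0 *
    (l i (zero_coord i v) * p i (zero_coord i v) ^+ k).[v i 0])).
  apply: eq_bigr => s _; congr (_ * _); rewrite exprS {1}qformE mulr_suml.
  by apply: eq_bigr => i _; rewrite hornerM horner_exp lE pE -mulrA qformE.
rewrite grid_mean_sum.
under eq_bigr => i _ do rewrite (grid_mean_by_parts _ xwP (sz i)).
rewrite -grid_mean_sum -!grid_meanZ -grid_meanD; apply: eq_bigr => s _.
congr (_ * _); under eq_bigr => i _ do rewrite dE.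
by rewrite big_split /= -mulr_suml -mulr_sumr -mulr_suml.
Qed.

(** * Inequalities between real powers and products *)

(** Concavity: the right-hand side is the tangent line at [c]. For [x > 0] it is the convexity of
    [expR] between [ln (x / c)] and [0]. *)
Lemma powR_le_tangent (R : realType) (a x c : R) :
  0 <= a <= 1 -> 0 <= x -> 0 < c ->
  x `^ a <= c `^ a * (1 - a + a * (x / c)).
Proof.
move=> /andP[a0 a1] x0 c0; set z := x / c.
have z0 : 0 <= z by rewrite divr_ge0// ltW.
have -> : x = c * z by rewrite /z mulrC divfK// gt_eqF.
rewrite powRM ?(ltW c0)// ler_wpM2l ?powR_ge0//.
have [z_eq0|z_neq0] := eqVneq z 0.
  rewrite z_eq0 mulr0 addr0 /powR eqxx; case: eqP => [->|_]; first by rewrite subr0.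
  by rewrite subr_ge0.
have z_gt0 : 0 < z by rewrite lt_neqAle eq_sym z_neq0.
rewrite /powR (negPf z_neq0).
have aI : Itv.spec (@Itv.num_sem R) (Itv.Real `[0%Z, 1%Z]) a.
  by apply/and3P; split=> //=; rewrite ?num_real//= bnd_simp.
have := @convex_expR R (Itv.mk aI) (ln z) 0.
rewrite !convRE /= mulr0 addr0 expR0 lnK ?posrE// mulr1.
by rewrite addrC.
Qed.

(** The convex counterpart, again with the tangent line at [c]. It is the concave case with exponent
    [(1 + a)^-1], applied to the powers [1 + a] of [x] and [c]. *)
Lemma bernoulli_powR (R : realType) (a x c : R) :
  0 <= a -> 0 <= x -> 0 < c ->
  c `^ (1 + a) * ((1 + a) * (x / c) - a) <= x `^ (1 + a).
Proof.
move=> a0 x0 c0; have s0 : 0 < 1 + a by rewrite ltr_wpDr.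
have sI : 0 <= (1 + a)^-1 <= 1 by rewrite invr_ge0 ltW//= invf_le1// lerDl.
have := powR_le_tangent sI (powR_ge0 x (1 + a)) (powR_gt0 (1 + a) c0).
rewrite -!powRrM divff ?gt_eqF// !powRr1 ?(ltW c0)// => xle.
rewrite -ler_pdivlMl ?powR_gt0// [leRHS]mulrC.
set y := _ / _ in xle *.
rewrite -ler_pdivrMl// in xle; rewrite mulrC in xle.
have -> : y = (1 + a) * (1 - (1 + a)^-1 + (1 + a)^-1 * y) - a.
  by rewrite mulrDr mulrBr mulr1 mulfV ?gt_eqF// mulVKf ?gt_eqF//; ring.
by rewrite lerB// ler_pM2l.
Qed.

(** [expR (-1/6) >= 5/6] gives [e <= (6/5)^6], just below [3]. *)
Lemma expR1_le3 (R : realType) : expR 1 <= 3 :> R.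
Proof.
have e6 : expR (- 6^-1) >= 5 / 6 :> R.
  by apply: le_trans (expR_ge1Dx _); lra.
have -> : expR 1 = (expR (- 6^-1) ^+ 6)^-1 :> R.
  by rewrite -expRM_natr -expRN; congr expR; field.
rewrite invf_ple ?posrE ?exprn_gt0 ?expR_gt0//.
have e60 : 0 <= 5 / 6 :> R by lra.
apply: le_trans (_ : (5 / 6) ^+ 6 <= _); first lra.
by rewrite lerXn2r// nnegrE// expR_ge0.
Qed.

(** The product is the Gaussian moment of order [2k]. From [m - 1] to [m] factors the left side is
    multiplied by [(m/2) (1 + 1/m)^m <= 3m/2], the product by [2m - 1], which is at least [3m/2] for
    [m >= 2]. *)
Lemma prod_odd_ge (R : realType) (k : nat) : (0 < k)%N ->
  (k.+1%:R / 2) ^+ k <= 2 * \prod_(j < k) (j.*2.+1)%:R :> R.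
Proof.
case: k => // k _; elim: k => [|k IH].
  by rewrite big_ord1 expr1 mulr1; lra.
rewrite big_ord_recr /= mulrA; set m := k.+2 in IH *.
have m0 : 0 < m%:R :> R by rewrite ltr0n.
have step : (m.+1%:R / 2) ^+ m <= (m%:R / 2) ^+ k.+1 * (k.+1.*2.+1)%:R :> R.
  have em : (1 + m%:R^-1) ^+ m <= 3 :> R.
    apply: le_trans (expR1_le3 R).
    have -> : expR 1 = expR m%:R^-1 ^+ m :> R.
      by rewrite -expRM_natr mulVf// gt_eqF.
    by rewrite lerXn2r ?nnegrE ?expR_ge0 ?expR_ge1Dx// addr_ge0// invr_ge0 ltW.
  have -> : m.+1%:R / 2 = m%:R / 2 * (1 + m%:R^-1) :> R.
    by rewrite -natr1; field; rewrite gt_eqF.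
  rewrite exprMn [X in X * _ <= _]exprSr -mulrA.
  rewrite ler_wpM2l ?exprn_ge0 ?divr_ge0 ?ler0n//.
  have m2 : 2 <= m%:R :> R by rewrite ler_nat.
  have -> : (k.+1.*2.+1)%:R = 2 * m%:R - 1 :> R.
    by rewrite /m -muln2 -natr1 natrM -natr1 -[k.+2%:R]natr1 -natr1; ring.
  apply: le_trans (_ : m%:R / 2 * 3 <= _); last by lra.
  by rewrite ler_wpM2l// divr_ge0// ler0n.
by apply: le_trans step _; rewrite ler_wpM2r ?ler0n.
Qed.

(** Interpolates [prod_odd_ge] to a real exponent. The base [2k - 1] is the ratio of the Gaussian
    moments of orders [2k] and [2k - 2], and [(k + a) / 2] does not exceed it. *)
Lemma prod_odd_powR_ge (R : realType) (k : nat) (a : R) :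
  (0 < k)%N -> 0 <= a <= 1 ->
  2^-1 * ((k%:R + a) / 2) `^ (k%:R + a) <=
  \prod_(j < k) (j.*2.+1)%:R * (k.*2.-1)%:R `^ a.
Proof.
move=> k0 /andP[a0 a1]; have k1 : 1 <= k%:R :> R by rewrite ler1n.
have b0 : 0 < (k%:R + a) / 2 by lra.
have b_neq0 : (k%:R + a) / 2 != 0 by rewrite gt_eqF.
rewrite powRD ?b_neq0 ?implybT// powR_mulrn ?(ltW b0)// mulrA.
apply: ler_pM; rewrite ?mulr_ge0 ?exprn_ge0 ?powR_ge0 ?invr_ge0 ?(ltW b0)//.
  rewrite ler_pdivrMl//; apply: le_trans (prod_odd_ge R k0).
  by rewrite lerXn2r ?nnegrE ?(ltW b0) ?divr_ge0// -[k.+1%:R]natr1; lra.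
apply: ge0_ler_powR => //; rewrite ?nnegrE ?(ltW b0)//.
have -> : (k.*2.-1)%:R = 2 * k%:R - 1 :> R.
  case: k k0 {k1 b0 b_neq0} => // k _; rewrite doubleS /= -muln2.
  by rewrite -[(k * 2).+1%:R]natr1 natrM -[k.+1%:R]natr1; ring.
by lra.
Qed.

(* Weighted AM-GM, via [y <= m * expR (y / m - 1)] for every factor. *)
Lemma prod_powR_le (R : realType) (k : nat) (a t o : R) :
  (0 < k)%N -> 0 <= a -> 0 <= t -> 0 <= o -> 0 < t + k.*2%:R * o ->
  \prod_(j < k) (t + j.*2%:R * o) * (t + k.*2%:R * o) `^ a <=
  (t + (k%:R + a) * o) `^ (k%:R + a).
Proof.
move=> k0 a0 t0 o0 c0; set c := t + _ in c0 *; set m := t + (k%:R + a) * o.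
have k1 : 1 <= k%:R :> R by rewrite ler1n.
have m0 : 0 < m.
  have := c0; rewrite /c /m -muln2 natrM => c0'.
  have := o0; rewrite le_eqVlt => /orP[/eqP o_eq|o_gt0]; first by nra.
  have : 0 < (k%:R + a) * o by rewrite mulr_gt0// ltr_wpDr// ltr0n.
  by lra.
have yle y : y <= m * expR (y / m - 1).
  rewrite -ler_pdivrMl// mulrC.
  by apply: le_trans (expR_ge1Dx _); rewrite subrKC.
have y0 j : 0 <= t + j.*2%:R * o by rewrite addr_ge0// mulr_ge0.
have m_neq0 : m != 0 by rewrite gt_eqF.
rewrite [leRHS]powRD ?m_neq0 ?implybT//.
have sumE : \sum_(j < k) (t + j.*2%:R * o) = k%:R * t + k%:R * (k%:R - 1) * o.
  elim: (k) => [|n IH]; first by rewrite big_ord0 !mul0r addr0.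
  by rewrite big_ord_recr /= IH -muln2 natrM -natr1; ring.
apply: le_trans (_ : \prod_(j < k) (m * expR ((t + j.*2%:R * o) / m - 1)) *
    (m * expR (c / m - 1)) `^ a <= _).
  rewrite ler_pM ?prodr_ge0 ?powR_ge0//.
    by apply: ler_prod => j _; rewrite y0 yle.
  by apply: ge0_ler_powR;
    rewrite ?nnegrE ?mulr_ge0 ?expR_ge0 ?yle ?(ltW m0) ?(ltW c0).
rewrite big_split prodr_const card_ord /= powRM ?expR_ge0 ?(ltW m0)//.
rewrite -expRM -expR_sum powR_mulrn ?(ltW m0)// mulrACA -expRD ger_pMr; last first.
  by rewrite mulr_gt0 ?exprn_gt0 ?powR_gt0.
(* The exponents add up to [- (k + a^2) o / m], which is nonpositive. *)
rewrite expR_le1 sumrB -mulr_suml sumE sumr_const card_ord.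
have -> : (k%:R * t + k%:R * (k%:R - 1) * o) / m - 1 *+ k + (c / m - 1) * a =
    ((k%:R * t + k%:R * (k%:R - 1) * o) + a * c - (k%:R + a) * m) / m.
  by field; rewrite gt_eqF.
rewrite pmulr_lle0 ?invr_gt0// /c /m -muln2 natrM.
have -> : k%:R * t + k%:R * (k%:R - 1) * o + a * (t + k%:R * 2 * o) -
    (k%:R + a) * (t + (k%:R + a) * o) = - ((k%:R + a ^+ 2) * o) by ring.
by rewrite oppr_le0 mulr_ge0// addr_ge0// sqr_ge0.
Qed.

(** * Fractional moments of quadratic and linear forms *)

(** Stein's identity gives [M (j+1) <= (tr S + 2 j o) M j] for the integer moments; the tangent line
    of the power [a] then bounds the fractional moment by [M k] and [M (k+1)]. *)
Lemma grid_mean_qform_powR_le (R : realType) (N d D k : nat) (x w : 'I_N -> R)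
    (S : 'M[R]_d) (o a : R) :
  stein_upto x w D -> (k.*2.+2 <= D)%N -> (0 < k)%N -> 0 <= a <= 1 ->
  S^T = S -> (forall v, 0 <= qform S v) -> 0 <= o ->
  (forall v, \sum_i (S *m v) i 0 ^+ 2 <= o * qform S v) ->
  grid_mean x w (fun v => qform S v `^ (k%:R + a)) <=
  (\tr S + (k%:R + a) * o) `^ (k%:R + a).
Proof.
move=> xwP kD k0 /andP[a0 a1] symS psd o0 oP.
have [w0 w1 _] := xwP.
pose M j := grid_mean x w (fun v => qform S v ^+ j).
have M0 j : 0 <= M j.
  by apply: sumr_ge0 => s _; rewrite mulr_ge0 ?prodr_ge0// exprn_ge0.
have trS0 := psd_trace_ge0 psd.
have MS j : (j <= k)%N -> M j.+1 <= (\tr S + j.*2%:R * o) * M j.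
  move=> jk; rewrite /M (grid_mean_qformS symS xwP); last first.
    by rewrite (leq_trans _ kD)// !ltnS leq_double.
  case: j {jk} => [|j]; first by rewrite !mul0r !addr0.
  rewrite [leRHS]mulrDl lerD2l -mulrA ler_wpM2l ?ler0n// -grid_meanZ.
  by apply: grid_mean_le => // v; rewrite exprS mulrA ler_wpM2r ?exprn_ge0.
have MP n : (n <= k)%N -> M n <= \prod_(j < n) (\tr S + j.*2%:R * o).
  elim: n => [|n IH] nk.
    by rewrite big_ord0 /M -[leRHS](grid_mean1 d x w1) grid_mean_le.
  rewrite big_ord_recr /= [leRHS]mulrC; apply: le_trans (MS _ (ltnW nk)) _.
  by rewrite ler_wpM2l ?IH ?(ltnW nk)// addr_ge0// mulr_ge0.
set c := \tr S + k.*2%:R * o.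
have : 0 <= c by rewrite addr_ge0// mulr_ge0.
(* If [c = 0], then [o = 0], so [S v = 0] and the form vanishes identically. *)
rewrite le_eqVlt => /orP[/eqP c_eq0|c0].
  have o_eq0 : o = 0.
    have k2 : 0 < k.*2%:R :> R by rewrite ltr0n double_gt0.
    by move: c_eq0; rewrite /c => c_eq0; nra.
  have Q0 v : qform S v = 0.
    by apply: qform_eq0; apply: le_trans (oP v) _; rewrite o_eq0 mul0r.
  rewrite /grid_mean big1 ?powR_ge0// => s _.
  by rewrite Q0 powR0 ?mulr0// gt_eqF// ltr_pwDl// ltr0n.
apply: le_trans (prod_powR_le k0 a0 trS0 o0 c0); rewrite -/c.
(* The tangent at [c], multiplied by [qform S v ^ k]. With this [c], the bound [M k.+1 <= c * M k]
   brings the bracket down to [M k]. *)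
apply: le_trans (_ : c `^ a * ((1 - a) * M k + a / c * M k.+1) <= _).
  rewrite -!grid_meanZ -grid_meanD -grid_meanZ; apply: grid_mean_le => // v.
  have -> : c `^ a * ((1 - a) * qform S v ^+ k + a / c * qform S v ^+ k.+1) =
      qform S v ^+ k * (c `^ a * (1 - a + a * (qform S v / c))).
    by rewrite exprS; ring.
  have [Q0|Q0] := eqVneq (qform S v) 0.
    rewrite Q0 powR0 ?expr0n ?gtn_eqF ?mul0r ?lexx//; last first.
      by rewrite gt_eqF// ltr_pwDl// ltr0n.
  rewrite powRD ?Q0 ?implybT// powR_mulrn// ler_wpM2l ?exprn_ge0//.
  by apply: powR_le_tangent; rewrite ?a0.
rewrite [leRHS]mulrC ler_wpM2l ?powR_ge0//; apply: le_trans (MP _ (leqnn k)).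
rewrite [leRHS](_ : _ = (1 - a) * M k + a / c * (c * M k)); last first.
  by field; rewrite gt_eqF.
rewrite lerD2l ler_wpM2l ?divr_ge0 ?(ltW c0)//.
exact: MS.
Qed.

Lemma qform_outer (R : realType) (d : nat) (g y : 'cV[R]_d) :
  qform (y *m y^T) g = dotv g y ^+ 2.
Proof.
rewrite qformE expr2 [X in X * _]/dotv mulr_suml; apply: eq_bigr => i _.
rewrite -mulmxA -mulrA; congr (_ * _); rewrite mxE big_ord1; congr (_ * _).
by rewrite mxE; apply: eq_bigr => j _; rewrite mxE mulrC.
Qed.

Lemma norm2_sqr (R : realType) (d : nat) (v : 'cV[R]_d) :
  norm2 v ^+ 2 = \sum_i v i 0 ^+ 2.
Proof. by rewrite sqr_sqrtr// sumr_ge0// => i _; rewrite sqr_ge0. Qed.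

Lemma sqrt_powR (R : realType) (y p : R) :
  0 <= y -> Num.sqrt y `^ p = y `^ (p / 2).
Proof. by move=> y0; rewrite -powR12_sqrt// -powRrM mulrC. Qed.

Lemma norm_powR2 (R : realType) (y p : R) : `|y| `^ p = (y ^+ 2) `^ (p / 2).
Proof. by rewrite -sqrt_powR ?sqr_ge0// sqrtr_sqr. Qed.

(** For the rank-one form [S = y y^T], [|S v|^2 = |y|^2 qform S v], so the recursion is an equality
    and the integer moments are [(2j - 1)!! |y|^(2j)]. Convexity handles the fractional exponent. *)
Lemma grid_mean_dotv_powR_ge (R : realType) (N d D k : nat) (x w : 'I_N -> R)
    (y : 'cV[R]_d) (a : R) :
  stein_upto x w D -> (k.*2.+2 <= D)%N -> (0 < k)%N -> 0 <= a <= 1 ->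
  2^-1 * ((k%:R + a) / 2) `^ (k%:R + a) * (norm2 y ^+ 2) `^ (k%:R + a) <=
  grid_mean x w (fun g => (dotv g y ^+ 2) `^ (k%:R + a)).
Proof.
move=> xwP kD k0 a01; have /andP[a0 a1] := a01.
have [w0 w1 _] := xwP.
set n2 := norm2 y ^+ 2; have : 0 <= n2 by exact: sqr_ge0.
have ka_neq0 : k%:R + a != 0 by rewrite gt_eqF// ltr_pwDl// ltr0n.
rewrite le_eqVlt => /orP[/eqP <-|n20].
  rewrite powR0 ?mulr0//; apply: sumr_ge0 => s _.
  by rewrite mulr_ge0 ?prodr_ge0 ?powR_ge0.
pose S := y *m y^T.
have symS : S^T = S by rewrite /S trmx_mul trmxK.
have trS : \tr S = n2.
  rewrite /n2 norm2_sqr /S mxtrace_mulC /mxtrace big_ord1 mxE.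
  by apply: eq_bigr => i _; rewrite mxE expr2.
pose M j := grid_mean x w (fun v => qform S v ^+ j).
have SvE v : \sum_i (S *m v) i 0 ^+ 2 = n2 * qform S v.
  rewrite qform_outer /n2 norm2_sqr mulr_suml; apply: eq_bigr => i _.
  rewrite -mulmxA mxE big_ord1 exprMn; congr (_ * _ ^+ 2).
  by rewrite mxE; apply: eq_bigr => j _; rewrite mxE mulrC.
have MS j : (j <= k)%N -> M j.+1 = j.*2.+1%:R * n2 * M j.
  move=> jk; rewrite /M (grid_mean_qformS symS xwP); last first.
    by rewrite (leq_trans _ kD)// !ltnS leq_double.
  rewrite trS; case: j {jk} => [|j]; first by rewrite !mul0r addr0 mul1r.
  have -> : grid_mean x w (fun v => (\sum_i (S *m v) i 0 ^+ 2) * qform S v ^+ j) =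
      n2 * M j.+1.
    rewrite /M -grid_meanZ; apply: eq_bigr => s _; congr (_ * _).
    by rewrite SvE [in RHS]exprS [RHS]mulrA.
  by rewrite -!/(M _) -[j.+1.*2.+1%:R]natr1; ring.
have MP n : (n <= k)%N -> M n = \prod_(j < n) (j.*2.+1)%:R * n2 ^+ n.
  elim: n => [|n IH] nk.
    rewrite big_ord0 expr0 mulr1 -[RHS](grid_mean1 d x w1).
    by apply: eq_bigr.
  by rewrite MS ?(ltnW nk)// IH ?(ltnW nk)// big_ord_recr /= exprS; ring.
(* From here [k] is one less: the exponent splits as [k + (1 + a)], whose second part is at least
   [1] and gives a convex power. *)
case: k k0 kD ka_neq0 MS MP => // k _ kD ka_neq0 MS MP.
(* The tangent point [c] is the ratio of consecutive moments [M k.+1 / M k]. *)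
pose c := k.*2.+1%:R * n2.
have c0 : 0 < c by rewrite mulr_gt0.
apply: le_trans (_ : c `^ a * M k.+1 <= _).
  have n2_neq0 : n2 != 0 by rewrite gt_eqF.
  rewrite MP// /c [(_ * n2) `^ _]powRM ?(ltW n20)//.
  rewrite [n2 `^ (_ + a)]powRD ?n2_neq0 ?implybT//.
  rewrite powR_mulrn ?(ltW n20)//.
  rewrite [leRHS](_ : _ = \prod_(j < k.+1) (j.*2.+1)%:R * k.*2.+1%:R `^ a *
    (n2 ^+ k.+1 * n2 `^ a)); last by ring.
  rewrite ler_wpM2r ?mulr_ge0 ?exprn_ge0 ?powR_ge0 ?(ltW n20) ?sqrtr_ge0//.
  exact: prod_odd_powR_ge.
(* Since [M k.+1 = c * M k], the tangent line averages to exactly [c^a M (k+1)]. *)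
rewrite [leLHS](_ : _ = c `^ (1 + a) * ((1 + a) / c * M k.+1 - a * M k)); last first.
  have c_neq0 : c != 0 by rewrite gt_eqF.
  rewrite MS// -/c powRD ?c_neq0 ?implybT// powRr1 ?(ltW c0)//.
  by field; rewrite gt_eqF.
rewrite -mulNr -!grid_meanZ -grid_meanD -grid_meanZ; apply: grid_mean_le => // g.
rewrite qform_outer; set q := dotv g y ^+ 2; have q0 : 0 <= q by exact: sqr_ge0.
rewrite [leLHS](_ : _ = q ^+ k * (c `^ (1 + a) * ((1 + a) * (q / c) - a))); last first.
  by rewrite exprS; ring.
rewrite -[k.+1%:R]natr1 -addrA.
have [->|q_neq0] := eqVneq q 0.
  rewrite [leRHS]powR0; last by rewrite addrA natr1.
  case: k {kD ka_neq0 MS MP c0} @c => [|k] c; last by rewrite exprS !mul0r.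
  rewrite expr0 mul1r mul0r mulr0 sub0r pmulr_rle0 ?oppr_le0//.
  by rewrite powR_gt0// mulr_gt0.
rewrite [leRHS]powRD ?q_neq0 ?implybT// powR_mulrn// ler_wpM2l ?(exprn_ge0 _ q0)//.
exact: bernoulli_powR.
Qed.

(** * Euclidean norm and operator norm *)

Lemma norm2Z (R : realType) (d : nat) (a : R) (u : 'cV[R]_d) :
  norm2 (a *: u) = `|a| * norm2 u.
Proof.
rewrite -sqrtr_sqr -sqrtrM ?sqr_ge0// mulr_sumr; congr Num.sqrt.
by apply: eq_bigr => i _; rewrite mxE exprMn.
Qed.

Lemma normr_coord_le_norm2 (R : realType) (d : nat) (u : 'cV[R]_d) (i : 'I_d) :
  `|u i 0| <= norm2 u.
Proof.
rewrite -sqrtr_sqr ler_wsqrtr// (bigD1 i)//= lerDl sumr_ge0// => j _.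
exact: sqr_ge0.
Qed.

Lemma has_sup_opnorm (R : realType) (d : nat) (M : 'M[R]_d) :
  has_sup [set norm2 (M *m u) | u in [set u : 'cV[R]_d | norm2 u <= 1]].
Proof.
split.
  by exists (norm2 (M *m 0)), 0 => //; rewrite /= -(scale0r 0) norm2Z normr0 mul0r.
exists (Num.sqrt (\sum_i (\sum_j `|M i j|) ^+ 2)) => _ [u /= u1 <-].
rewrite ler_wsqrtr//; apply: ler_sum => i _.
rewrite -real_normK ?num_real// lerXn2r ?nnegrE ?sumr_ge0//.
rewrite mxE; apply: le_trans (ler_norm_sum _ _ _) _; apply: ler_sum => j _.
by rewrite normrM ler_piMr// (le_trans (normr_coord_le_norm2 u j)).
Qed.

Lemma opnorm_ge0 (R : realType) (d : nat) (M : 'M[R]_d) : 0 <= opnorm M.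
Proof.
apply: le_trans (sqrtr_ge0 _) (sup_upper_bound (has_sup_opnorm M) _).
by exists 0 => //; rewrite /= -(scale0r 0) norm2Z normr0 mul0r.
Qed.

Lemma norm2_mulmx_le (R : realType) (d : nat) (M : 'M[R]_d) (u : 'cV[R]_d) :
  norm2 (M *m u) <= opnorm M * norm2 u.
Proof.
have [u0|u_neq0] := eqVneq (norm2 u) 0.
  suff -> : u = 0 by rewrite mulmx0 -(scale0r 0) norm2Z normr0 !mul0r mulr0.
  apply/colP => i; apply/eqP; rewrite mxE -normr_eq0 eq_le normr_ge0 andbT -u0.
  exact: normr_coord_le_norm2.
have u_gt0 : 0 < norm2 u by rewrite lt_neqAle eq_sym u_neq0 sqrtr_ge0.
rewrite -ler_pdivrMr// mulrC.
have -> : (norm2 u)^-1 * norm2 (M *m u) = norm2 (M *m ((norm2 u)^-1 *: u)).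
  by rewrite -scalemxAr norm2Z ger0_norm// invr_ge0 ltW.
apply: (sup_upper_bound (has_sup_opnorm M)); exists ((norm2 u)^-1 *: u) => //=.
by rewrite norm2Z ger0_norm ?mulVf// invr_ge0 ltW.
Qed.

(* The nonnegativity of [qform S (v - t *: S v)] at [t = (opnorm S)^-1]. *)
Lemma sqr_mulmx_le_qform (R : realType) (d : nat) (S : 'M[R]_d) (v : 'cV[R]_d) :
  S^T = S -> (forall u, 0 <= qform S u) ->
  \sum_i (S *m v) i 0 ^+ 2 <= opnorm S * qform S v.
Proof.
move=> symS psd; set o := opnorm S; set y := S *m v; rewrite -norm2_sqr.
have o0 : 0 <= o := opnorm_ge0 S.
have ySy : norm2 (S *m y) <= o * norm2 y := norm2_mulmx_le S y.
move: o0; rewrite le_eqVlt => /orP[/eqP o_eq|o_gt0].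
  rewrite -o_eq mul0r; have := norm2_mulmx_le S v.
  rewrite -/o -o_eq mul0r -/y => y0.
  by rewrite (@le_anti _ _ (norm2 y) 0) ?expr0n// y0 sqrtr_ge0.
(* Cauchy-Schwarz in the form [2 o <y, S y> <= o^2 |y|^2 + |S y|^2], combined with
   [|S y| <= o |y|]. *)
have Qy : qform S y <= o * norm2 y ^+ 2.
  have : 2 * o * qform S y <= o ^+ 2 * norm2 y ^+ 2 + norm2 (S *m y) ^+ 2.
    rewrite qformE !norm2_sqr !mulr_sumr -big_split; apply: ler_sum => i _ /=.
    by have := sqr_ge0 (o * y i 0 - (S *m y) i 0); rewrite sqrrB; nra.
  have : norm2 (S *m y) ^+ 2 <= o ^+ 2 * norm2 y ^+ 2.
    by rewrite -exprMn lerXn2r ?nnegrE ?mulr_ge0 ?sqrtr_ge0 ?(ltW o_gt0).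
  move=> le1 le2; rewrite -(ler_pM2l (mulr_gt0 (ltr0n R 2) o_gt0)).
  by nra.
have := psd (v - o^-1 *: y).
have -> : qform S (v - o^-1 *: y) =
    qform S v - 2 * o^-1 * norm2 y ^+ 2 + o^-1 ^+ 2 * qform S y.
  have vSy : \sum_i v i 0 * (S *m y) i 0 = norm2 y ^+ 2.
    rewrite norm2_sqr; under eq_bigr => i _ do rewrite mxE mulr_sumr.
    rewrite exchange_big; apply: eq_bigr => j _; rewrite expr2 -[X in _ = X]mulrC.
    rewrite {3}/y mxE mulr_sumr; apply: eq_bigr => i _.
    by rewrite -{1}symS mxE; ring.
  have subE (a b : 'cV[R]_d) i : (a - o^-1 *: b) i 0 = a i 0 - o^-1 * b i 0.
    by rewrite !mxE.
  rewrite !qformE norm2_sqr -mulrA.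
  have -> : \sum_i (v - o^-1 *: y) i 0 * (S *m (v - o^-1 *: y)) i 0 =
      \sum_i (v i 0 * y i 0 - o^-1 * (v i 0 * (S *m y) i 0) - o^-1 * y i 0 ^+ 2 +
        o^-1 ^+ 2 * (y i 0 * (S *m y) i 0)).
    apply: eq_bigr => i _; rewrite mulmxBr -scalemxAr -/y.
    by rewrite !subE; ring.
  rewrite big_split sumrB sumrB -!mulr_sumr /= vSy norm2_sqr; ring.
move=> Q0; have oi_gt0 : 0 < o^-1 by rewrite invr_gt0.
have : o^-1 ^+ 2 * qform S y <= o^-1 * norm2 y ^+ 2.
  rewrite -[leRHS](_ : o^-1 ^+ 2 * (o * norm2 y ^+ 2) = _).
    by rewrite ler_wpM2l// sqr_ge0.
  by field; rewrite gt_eqF.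
move=> Qy'; rewrite -ler_pdivrMl//; lra.
Qed.

(** * Covariance matrices and measurability *)

(** Both claims share one induction because additivity of the covariance needs the partial sums to
    be square integrable. *)
Lemma covariance_suml (R : realType) (d0 : measure_display)
    (T : measurableType d0) (P : probability T R) (I : Type) (X : I -> T -> R)
    (Y : T -> R) (u : I -> R) (s : seq I) :
  (forall i, X i \in Lfun P 2%:E) -> Y \in Lfun P 2%:E ->
  (\sum_(i <- s) (u i \o* X i) \in Lfun P 2%:E) /\
  covariance P (\sum_(i <- s) (u i \o* X i)) Y =
    (\sum_(i <- s) (u i)%:E * covariance P (X i) Y)%E.
Proof.
move=> X2 Y2; have P2 : P setT \is a fin_num := fin_num_measure P _ measurableT.
elim: s => [|i s [IHL IHc]].
  rewrite !big_nil; split; first exact: (Lfun_cst P 0 2).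
  exact: covariance_cst_l.
have uX2 : u i \o* X i \in Lfun P 2%:E by apply: Lfun_scale => //; rewrite ler1n.
rewrite !big_cons; split.
  have le12 : (1 <= 2%:E :> \bar R)%E by rewrite lee_fin ler1n.
  by have [_ LD] := Lfun_addr_closed P le12; exact: LD.
rewrite covarianceDl// IHc covarianceZl//; try exact: Lfun_subset12.
exact: Lfun2_mul_Lfun1.
Qed.

(** [qform S u] is the variance of the linear combination of the [X i] with coefficients [u i 0]. *)
Lemma covariance_mx_psd (R : realType) (d0 : measure_display)
    (T : measurableType d0) (P : probability T R) (d : nat) (X : 'I_d -> T -> R)
    (S : 'M[R]_d) :
  (forall i, X i \in Lfun P 2%:E) ->
  (forall i j, covariance P (X i) (X j) = (S i j)%:E) ->
  S^T = S /\ forall u, 0 <= qform S u.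
Proof.
move=> X2 XS; split=> [|u].
  apply/matrixP => i j; rewrite mxE; apply: EFin_inj.
  by rewrite -!XS covarianceC.
pose Y := \sum_(i <- index_enum 'I_d) (u i 0 \o* X i).
have cov_Y Z := @covariance_suml _ _ _ P _ X Z (fun i => u i 0) (index_enum 'I_d) X2.
have Y2 : Y \in Lfun P 2%:E.
  have P2 : P setT \is a fin_num := fin_num_measure P _ measurableT.
  exact: (cov_Y _ (Lfun_cst P 0 2)).1.
have := variance_ge0 P Y; rewrite /variance (cov_Y _ Y2).2.
under eq_bigr => i _ do rewrite covarianceC (cov_Y _ (X2 i)).2.
under eq_bigr => i _ do under eq_bigr => j _ do rewrite XS -EFinM.
under eq_bigr => i _ do rewrite sumEFin -EFinM.
rewrite sumEFin lee_fin qformE; congr (_ <= _); apply: eq_bigr => i _.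
congr (_ * _); rewrite mxE; apply: eq_bigr => j _.
have -> : S j i = S i j by apply: EFin_inj; rewrite -!XS covarianceC.
by rewrite mulrC.
Qed.

Lemma measurable_norm2 (R : realType) (d0 : measure_display)
    (T : measurableType d0) (P : probability T R) (d : nat)
    (X : 'I_d -> {RV P >-> R}) :
  measurable_fun setT (fun w => norm2 (rvec X w)).
Proof.
apply: (eq_measurable_fun (fun w => (\sum_i rvec X w i 0 * rvec X w i 0) `^ 2^-1)).
  move=> w _; rewrite powR12_sqrt; last first.
    by apply: sumr_ge0 => i _; rewrite -expr2 sqr_ge0.
  by congr Num.sqrt; apply: eq_bigr => i _; rewrite expr2.
apply: (@measurableT_comp _ _ _ _ _ _ (@powR R ^~ 2^-1)).
  exact: measurable_powR.
by apply: measurable_sum => i; apply: measurable_funM;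
  apply: eq_measurable_fun (measurable_funPT (X i)) => w _; rewrite mxE.
Qed.

Lemma measurable_dotv (R : realType) (d0 : measure_display)
    (T : measurableType d0) (P : probability T R) (d : nat)
    (X : 'I_d -> {RV P >-> R}) (u : 'cV[R]_d) :
  measurable_fun setT (fun w => dotv u (rvec X w)).
Proof.
apply: measurable_sum => i; apply: measurable_funM => //.
by apply: eq_measurable_fun (measurable_funPT (X i)) => w _; rewrite mxE.
Qed.

(** * Moments and tails of the norm of the random vector *)

(** Averaging over grid points [g] gives [b E|X|^p <= E_g E|<g, X>|^p <= h^p E_g (g^T S g)^(p/2)].
    The factor [2] in front comes from the [1/2] in [b] and later becomes the [ln 2] of the tail
    bound. *)
Lemma expectation_norm2_powR_le (R : realType) (d0 : measure_display)
    (T : measurableType d0) (P : probability T R) (d : nat)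
    (X : 'I_d -> {RV P >-> R}) (S : 'M[R]_d) (p h : R) :
  S^T = S -> (forall u, 0 <= qform S u) -> 2 <= p -> 0 <= h ->
  (forall u, (\int[P]_w (`|dotv u (rvec X w)| `^ p)%:E <=
     ((h * norm_mx S u) `^ p)%:E)%E) ->
  (\int[P]_w (norm2 (rvec X w) `^ p)%:E <=
   (2 * (2 * p `^ (- 2^-1) * h * Num.sqrt (\tr S + p / 2 * opnorm S)) `^ p)%:E)%E.
Proof.
move=> symS psd p2 h0 hp.
have p_gt0 : 0 < p by lra.
(* The moment exponent [p / 2] splits as [k + a], with [k >= 1] because [p >= 2]. *)
pose k := Num.truncn (p / 2); pose a := p / 2 - k%:R.
have k_itv : k%:R <= p / 2 < k.+1%:R by apply: truncn_itv; lra.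
have k0 : (0 < k)%N.
  by case: k k_itv {a} => [|//] => /andP[_]; lra.
have a01 : 0 <= a <= 1.
  rewrite /a; move: k_itv; rewrite -[k.+1%:R]natr1 => /andP[? ?].
  by apply/andP; split; lra.
have kaE : k%:R + a = p / 2 by rewrite /a; ring.
have [x [w xwP]] := gauss_quadrature R k.*2.+2.
have [w0 _ _] := xwP.
pose W (s : {ffun 'I_d -> 'I_(k.*2.+2).+1}) := \prod_i w (s i).
have W0 s : 0 <= W s by exact: prodr_ge0.
pose b := 2^-1 * (p / 2 / 2) `^ (p / 2).
have b0 : 0 < b by rewrite mulr_gt0 ?powR_gt0//; lra.
have mdot u : measurable_fun setT (fun w => (`|dotv u (rvec X w)| `^ p)%:E).
  apply/measurable_EFinP.
  apply: (@measurableT_comp _ _ _ _ _ _ (@powR R ^~ p)).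
    exact: measurable_powR.
  by apply: (measurableT_comp (@normr_measurable R setT)); exact: measurable_dotv.
have mnorm : measurable_fun setT (fun w => (norm2 (rvec X w) `^ p)%:E).
  apply/measurable_EFinP.
  apply: (@measurableT_comp _ _ _ _ _ _ (@powR R ^~ p)).
    exact: measurable_powR.
  exact: measurable_norm2.
have lower : (b%:E * \int[P]_w (norm2 (rvec X w) `^ p)%:E <=
    \sum_s (W s)%:E * \int[P]_w (`|dotv (grid x s) (rvec X w)| `^ p)%:E)%E.
  rewrite -ge0_integralZl//=; last 2 first.
  - by move=> v _; rewrite lee_fin powR_ge0.
  - by rewrite lee_fin ltW.
  rewrite (eq_bigr (fun s => \int[P]_w
    ((W s)%:E * (`|dotv (grid x s) (rvec X w)| `^ p)%:E))%E); last first.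
    by move=> s _; apply/esym/ge0_integralZl => // *; rewrite lee_fin ?powR_ge0.
  rewrite -ge0_integral_sum//=; last 2 first.
  - by move=> s; apply: emeasurable_funM.
  - by move=> s v _; rewrite mule_ge0 ?lee_fin ?powR_ge0.
  apply: ge0_le_integral => //=.
  - by move=> v _; rewrite mule_ge0 ?lee_fin ?powR_ge0// ltW.
  - exact: emeasurable_funM.
  - by apply: emeasurable_sum => s; apply: emeasurable_funM.
  move=> v _; under eq_bigr => s _ do rewrite -EFinM.
  rewrite sumEFin -EFinM lee_fin.
  have := grid_mean_dotv_powR_ge (rvec X v) xwP (leqnn _) k0 a01.
  rewrite kaE -!/b -norm_powR2 ger0_norm ?sqrtr_ge0// => /le_trans; apply.
  rewrite /grid_mean le_eqVlt; apply/orP/or_introl/eqP.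
  by apply: eq_bigr => s _; rewrite -norm_powR2.
have upper : (\sum_s (W s)%:E * \int[P]_w (`|dotv (grid x s) (rvec X w)| `^ p)%:E <=
    ((h * Num.sqrt (\tr S + p / 2 * opnorm S)) `^ p)%:E)%E.
  apply: le_trans (_ : (\sum_s (W s)%:E * ((h * norm_mx S (grid x s)) `^ p)%:E <= _)%E).
    by apply: lee_sum => s _; rewrite lee_wpmul2l ?lee_fin.
  under eq_bigr => s _ do rewrite -EFinM.
  rewrite sumEFin lee_fin powRM ?sqrtr_ge0//.
  have := grid_mean_qform_powR_le xwP (leqnn _) k0 a01 symS psd (opnorm_ge0 S)
    (fun v => sqr_mulmx_le_qform v symS psd).
  rewrite kaE => /(ler_wpM2l (powR_ge0 h p)).
  rewrite sqrt_powR; last first.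
    by rewrite addr_ge0 ?psd_trace_ge0// mulr_ge0 ?opnorm_ge0//; lra.
  apply: le_trans; rewrite -grid_meanZ le_eqVlt; apply/orP/or_introl/eqP.
  apply: eq_bigr => s _.
  by rewrite /norm_mx -/(qform S _) powRM ?sqrtr_ge0// sqrt_powR.
have := le_trans lower upper; rewrite -lee_pdivlMl// => /le_trans; apply.
set y := h * Num.sqrt _; rewrite -mulrA -/y.
have y0 : 0 <= y by rewrite mulr_ge0 ?sqrtr_ge0.
rewrite -EFinM lee_fin powRM ?mulr_ge0 ?powR_ge0// mulrA ler_wpM2r ?powR_ge0//.
(* What remains is [1 <= b * 2 * (2 p^(-1/2))^p], an equality since
   [(2 p^(-1/2))^p = (4/p)^(p/2)]. *)
rewrite -[leLHS]mulr1 ler_pdivrMl// /b.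
rewrite -[X in X `^ p]ger0_norm ?mulr_ge0 ?powR_ge0// norm_powR2.
rewrite mulrACA mulVf ?pnatr_eq0// mul1r -powRM; last 2 first.
- by lra.
- exact: sqr_ge0.
rewrite exprMn -[(p `^ _) ^+ 2]powR_mulrn ?powR_ge0// -powRrM.
have -> : - 2^-1 * 2%:R = -1 :> R by field.
rewrite powR_inv1 ?(ltW p_gt0)//.
have -> : p / 2 / 2 * (2 ^+ 2 / p) = 1 by field; rewrite gt_eqF.
by rewrite powR1.
Qed.

(** Markov's inequality for the power [p], as [2 B^p = (B e^((t + ln 2)/p))^p e^(-t)]. The strict
    inequality forces [0 < M] even when [B = 0], so [M^p] can be cancelled. *)
Lemma norm2_tail (R : realType) (d0 : measure_display)
    (T : measurableType d0) (P : probability T R) (d : nat)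
    (X : 'I_d -> {RV P >-> R}) (p B t M : R) :
  0 < p -> 0 <= B ->
  (\int[P]_w (norm2 (rvec X w) `^ p)%:E <= (2 * B `^ p)%:E)%E ->
  B * expR ((t + ln 2) / p) < M ->
  ((1 - expR (- t))%:E <= P [set w | (norm2 (rvec X w) <= M)%R])%E.
Proof.
move=> p_gt0 B0 EX BM; have M0 : 0 < M.
  by apply: le_lt_trans BM; rewrite mulr_ge0 ?expR_ge0.
have mX := measurable_norm2 X.
have mA : measurable [set w | norm2 (rvec X w) <= M].
  by rewrite -[X in measurable X]setTI; apply: measurable_fun_le.
have CE : [set w | M < norm2 (rvec X w)] = ~` [set w | norm2 (rvec X w) <= M].
  by apply/seteqP; split=> w /= => [|/negP]; rewrite ltNge => // /negP.
have mC : measurable [set w | M < norm2 (rvec X w)] by rewrite CE; exact: measurableC.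
rewrite -[X in P X]setCK -CE.
rewrite probability_setC// EFinB leeB//.
rewrite -(@lee_pmul2l _ (M `^ p)%:E) ?lte_fin ?powR_gt0//.
apply: le_trans (_ : \int[P]_w (norm2 (rvec X w) `^ p)%:E <= _)%E; last first.
  apply: le_trans EX _; rewrite -EFinM lee_fin.
  have -> : 2 * B `^ p = (B * expR ((t + ln 2) / p)) `^ p * expR (- t).
    rewrite powRM ?expR_ge0// -expRM divfK ?gt_eqF// -mulrA -expRD addrAC subrr add0r.
    by rewrite lnK ?posrE// mulrC.
  rewrite ler_wpM2r ?expR_ge0//.
  apply: ge0_ler_powR (ltW p_gt0) _ _ _ _ (ltW BM).
    by rewrite nnegrE mulr_ge0// expR_ge0.
  by rewrite nnegrE ltW.
have -> : P [set w | M < norm2 (rvec X w)] =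
    (\int[P]_w (\1_[set w | M < norm2 (rvec X w)] w)%:E)%E.
  by rewrite integral_indic// setIT.
have mI : measurable_fun setT (fun w => (\1_[set w | M < norm2 (rvec X w)] w)%:E : \bar R).
  by apply/measurable_EFinP; exact: measurable_indic.
rewrite -ge0_integralZl//=; last by rewrite lee_fin powR_ge0.
apply: ge0_le_integral => //=.
- by move=> w _; rewrite mule_ge0 ?lee_fin ?powR_ge0.
- exact: emeasurable_funM.
- apply/measurable_EFinP.
  by apply: (@measurableT_comp _ _ _ _ _ _ (@powR R ^~ p)) => //; exact: measurable_powR.
move=> w _; rewrite -EFinM lee_fin indicE.
have [|_] := boolP (w \in _); last by rewrite mulr0 powR_ge0.
rewrite inE /= mulr1 => /ltW Mw.
by apply: ge0_ler_powR (ltW p_gt0) _ _ _ _ Mw; rewrite nnegrE ?sqrtr_ge0 ?(ltW M0).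
Qed.

Theorem theorem1 (R : realType) (d0 : measure_display) (T : measurableType d0)
  (P : probability T R) (d : nat) (X : 'I_d -> {RV P >-> R})
  (Sigma : 'M[R]_d) (h : R -> \bar R)
  (hL2 : forall i : 'I_d, (X i : T -> R) \in Lfun P 2%:E)
  (hcentered : forall i : 'I_d, ('E_P[X i] = 0)%E)
  (hSigma : forall i j : 'I_d, covariance P (X i) (X j) = (Sigma i j)%:E)
  (hge0 : forall p : R, 1 <= p -> (0 <= h p)%E)
  (hmono : forall p q : R, 1 <= p -> p <= q -> (h p <= h q)%E)
  (hmoment : forall (u : 'cV[R]_d) (p : R), 2 <= p ->
     (('E_P[(fun w => `|dotv u (rvec X w)| `^ p)%R] `^ p^-1)
        <= h p * (norm_mx Sigma u)%:E)%E)
  (t : R) (ht : 0 < t) :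
  ((1 - expR (- t))%:E <=
   P [set w | (norm2 (rvec X w))%:E <=
     ereal_inf [set (2 * p `^ (- 2^-1))%:E * h p
                    * (Num.sqrt (\tr Sigma + p / 2 * opnorm Sigma))%:E
                    * (expR ((t + ln 2) / p))%:E
               | p in [set p : R | (2 <= p)%R]]])%E.
Proof.
have [symS psd] := covariance_mx_psd hL2 hSigma.
have trS0 := psd_trace_ge0 psd.
pose bound p := ((2 * p `^ (- 2^-1))%:E * h p
  * (Num.sqrt (\tr Sigma + p / 2 * opnorm Sigma))%:E * (expR ((t + ln 2) / p))%:E)%E.
(* One exponent at a time, at levels strictly above its bound, because the infimum need not be
   attained. *)
have tail p M : 2 <= p -> (bound p < M%:E)%E ->
    ((1 - expR (- t))%:E <= P [set w | (norm2 (rvec X w) <= M)%R])%E.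
  move=> p2; have p_gt0 : 0 < p by lra.
  rewrite /bound; set s := Num.sqrt _ => bM.
  (* If [h p = +oo], then [bound p] is finite only through [+oo * 0 = 0], when
     [norm_mx Sigma] vanishes and [h p] may be replaced by [0]. *)
  have [h0 h0_ge0 [h0P h0M]] : exists2 h0 : R, 0 <= h0 &
      (forall u, h p * (norm_mx Sigma u)%:E <= (h0 * norm_mx Sigma u)%:E)%E /\
      2 * p `^ (- 2^-1) * h0 * s * expR ((t + ln 2) / p) < M.
    have := hge0 p (le_trans (ler1n R 2) p2); move: bM.
    case: (h p) => [r| |//] bM r0.
      by exists r => //; split=> [u|]; rewrite -?lte_fin ?EFinM.
    have := sqrtr_ge0 (\tr Sigma + p / 2 * opnorm Sigma); rewrite -/s le_eqVlt.
    move=> /orP[/eqP s_eq0|s_gt0]; last first.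
      move: bM; rewrite gt0_muley ?lte_fin ?mulr_gt0 ?powR_gt0//.
      by rewrite gt0_mulye ?lte_fin// gt0_mulye ?lte_fin ?expR_gt0// ltNge leey.
    exists 0 => //; rewrite mulr0 !mul0r; split; last first.
      by move: bM; rewrite -s_eq0 mule0 mul0e lte_fin.
    move=> u; suff Q0 : qform Sigma u = 0.
      by rewrite /norm_mx -/(qform Sigma u) Q0 sqrtr0 mulr0 mule0.
    apply: qform_eq0; apply: le_trans (sqr_mulmx_le_qform u symS psd) _.
    have o0 := opnorm_ge0 Sigma.
    have : \tr Sigma + p / 2 * opnorm Sigma <= 0 by rewrite -sqrtr_eq0 -/s -s_eq0.
    move=> tro_le0; suff -> : opnorm Sigma = 0 by rewrite mul0r.
    by apply/eqP; rewrite eq_le o0 andbT; nra.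
  apply: (norm2_tail p_gt0 _ _ h0M); first by rewrite !mulr_ge0 ?powR_ge0 ?sqrtr_ge0.
  apply: expectation_norm2_powR_le => // u.
  have y0 : 0 <= h0 * norm_mx Sigma u by rewrite mulr_ge0 ?sqrtr_ge0.
  have := le_trans (hmoment u p p2) (h0P u); rewrite unlock.
  set I := (\int[P]_w _)%E => I_le.
  have I0 : (0 <= I)%E by apply: integral_ge0 => w _; rewrite lee_fin powR_ge0.
  (* Raising to the power [p] undoes the root in [hmoment]. *)
  have := @gt0_ler_poweR R p (ltW p_gt0) _ _ _ _ I_le.
  rewrite -poweRrM mulVf ?gt_eqF// poweRe1// poweR_EFin; apply.
  - by rewrite in_itv /= poweR_ge0 leey.
  - by rewrite in_itv /= lee_fin y0 leey.
set C := ereal_inf _.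
have [CE|CM] : C = +oo%E \/ C \is a fin_num.
  have : (0 <= C)%E.
    apply/ereal_infP => _ [p /= p2 <-].
    by rewrite !mule_ge0 ?lee_fin ?mulr_ge0 ?powR_ge0 ?sqrtr_ge0
      ?expR_ge0 ?hge0// (le_trans _ p2) ?ler1n.
  by case: (C) => [r| |]; [right|left|].
  rewrite CE (_ : [set w | _] = setT) ?probability_setT.
    by rewrite lee_fin gerBl expR_ge0.
  by apply/seteqP; split=> // w _ /=; rewrite leey.
(* The event is the decreasing intersection of the [A n]. Each level [C + 1/(n+1)] exceeds the bound
   of some [p], and continuity from above passes to the limit. *)
pose A n := [set w | norm2 (rvec X w) <= fine C + n.+1%:R^-1].
have mA M : measurable [set w | norm2 (rvec X w) <= M].
  rewrite -[X in measurable X]setTI; apply: measurable_fun_le => //.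
  exact: measurable_norm2.
have -> : [set w | ((norm2 (rvec X w))%:E <= C)%E] = \bigcap_n A n.
  rewrite -(fineK CM); apply/seteqP; split=> w /=.
    by rewrite lee_fin => wC n _; rewrite /A /= (le_trans wC)// lerDl invr_ge0.
  move=> wA; rewrite lee_fin; apply/ler_addgt0Pr => e e0.
  have [n] := ltr_add_invr e0; rewrite add0r => ne.
  by apply: le_trans (wA n I) _; rewrite lerD2l ltW.
have PA : (P \o A) n @[n --> \oo] --> P (\bigcap_n A n).
  apply: nonincreasing_cvg_mu => [|n||m n mn].
  - by rewrite (le_lt_trans (probability_le1 P (mA _)))// ltry.
  - exact: mA.
  - by apply: bigcapT_measurable => n; exact: mA.
  - rewrite subsetEset => w /le_trans; apply.
    by rewrite lerD2l lef_pV2 ?posrE// ler_nat.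
rewrite -(cvg_lim _ PA)//; apply: lime_ge; first by apply/cvg_ex; eexists; exact: PA.
apply: nearW => n.
have n0 : 0 < n.+1%:R^-1 :> R by rewrite invr_gt0.
have [_ [p /= p2 <-] lt_p] := lb_ereal_inf_adherent n0 CM.
by apply: (tail p _ p2); rewrite EFinD fineK.
Qed.
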